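(* Let $\theta$ be an ATL-formula and let $\mathcal H=(\Sigma,S,d,\delta,H)$ be a (perfect-recall) concurrent game Hintikka structure for $\theta$. Then $\mathcal H$ can be expanded to a CGM satisfying $\theta$: there is a labeling $L:S\to\mathcal P(AP)$ (namely $L(s)=H(s)\cap AP$) such that the CGM $(\Sigma,S,d,\delta,AP,L)$ satisfies $\theta$ at some state.
   Context: ATL-formulae over a set AP of atoms and a finite non-empty agent set $\Sigma$: $\varphi ::= p \mid \neg\varphi \mid (\varphi_1\to\varphi_2)\mid \langle\langle A\rangle\rangle\bigcirc\varphi \mid \langle\langle A\rangle\rangle\Box\varphi \mid \langle\langle A\rangle\rangle \varphi_1\,\mathcal{U}\,\varphi_2$, $A\subseteq\Sigma$; $\wedge$, $\top$ defined as usual. A concurrent game frame (CGF) is $(\Sigma,S,d,\delta)$ with $S\ne\emptyset$, $d_a(s)\ge1$ moves $D_a(s)=\{0,\dots,d_a(s)-1\}$ for agent $a$ at $s$, move vectors $D(s)=\prod_a D_a(s)$, and $\delta(s,\sigma)\in S$; a CGM additionally has $AP$ and $L:S\to\mathcal P(AP)$. An $A$-move $\sigma_A$ at $s$ picks a move for each $a\in A$; $out(s,\sigma_A)=\{\delta(s,\sigma):\sigma\in D(s)\text{ agrees with }\sigma_A\text{ on }A\}$. A co-$A$-move at $s$ is a function $c$ from $A$-moves at $s$ to $D(s)$ with $c(\sigma_A)$ agreeing with $\sigma_A$ on $A$; $out(s,c)=\{\delta(s,c(\sigma_A))\}$. A run is an infinite sequence of states each a $\delta$-successor of the previous one. A perfect-recall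 $A$-strategy (resp. co-$A$-strategy) $F$ maps each non-empty finite sequence of states ending at $t$ to an $A$-move (resp. co-$A$-move) at $t$; $out(s,F)$ is the set of runs $\lambda$ with $\lambda[0]=s$ and $\lambda[i+1]\in out(\lambda[i],F(\lambda[0],\dots,\lambda[i]))$. Satisfaction in a CGM: $s\Vdash p$ iff $p\in L(s)$; Boolean clauses usual; $s\Vdash\langle\langle A\rangle\rangle\bigcirc\varphi$ iff some $A$-move at $s$ has $\varphi$ true throughout its outcome; $s\Vdash\langle\langle A\rangle\rangle\Box\varphi$ iff some perfect-recall $A$-strategy $F$ has $\varphi$ true at every position of every $\lambda\in out(s,F)$; $s\Vdash\langle\langle A\rangle\rangle\varphi\,\mathcal U\,\psi$ iff some perfect-recall $A$-strategy $F$ ensures each $\lambda\in out(s,F)$ has $i$ with $\psi$ at $\lambda[i]$ and $\varphi$ at $\lambda[j]$ for $j<i$. $\alpha$-formulae and components: $\neg\neg\varphi$ ($\varphi,\varphi$); $\neg(\varphi\to\psi)$ ($\varphi,\neg\psi$); $\neg\langle\langle\Sigma\rangle\rangle\bigcirc\varphi$ ($\langle\langle\emptyset\rangle\rangle\bigcirc\neg\varphi$ twice); $\langle\langle A\rangle\rangle\Box\varphi$ ($\varphi$, $\langle\langle A\rangle\rangle\bigcirc\langle\langle A\rangle\rangle\Box\varphi$). $\beta$-formulae and components: $\varphi\to\psi$ ($\neg\varphi$, $\psi$); $\langle\langle A\rangle\rangle\varphi\,\mathcal U\,\psi$ ($\psi$, $\varphi\wedge\langle\langle A\rangle\rangle\bigcirc\langle\langle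 A\rangle\rangle\varphi\,\mathcal U\,\psi$); $\neg\langle\langle A\rangle\rangle\varphi\,\mathcal U\,\psi$ ($\neg\psi\wedge\neg\varphi$, $\neg\psi\wedge\neg\langle\langle A\rangle\rangle\bigcirc\langle\langle A\rangle\rangle\varphi\,\mathcal U\,\psi$); $\neg\langle\langle A\rangle\rangle\Box\varphi$ ($\neg\varphi$, $\neg\langle\langle A\rangle\rangle\bigcirc\langle\langle A\rangle\rangle\Box\varphi$). A (perfect-recall) concurrent game Hintikka structure (CGHS) is $(\Sigma,S,d,\delta,H)$ where $(\Sigma,S,d,\delta)$ is a CGF and $H$ labels each $s\in S$ with a set of ATL-formulae such that: (H1) if $\neg\varphi\in H(s)$ then $\varphi\notin H(s)$; (H2) if $\alpha\in H(s)$ then $\alpha_1,\alpha_2\in H(s)$; (H3) if $\beta\in H(s)$ then $\beta_1\in H(s)$ or $\beta_2\in H(s)$; (H4) if $\langle\langle A\rangle\rangle\bigcirc\varphi\in H(s)$ there is an $A$-move $\sigma_A$ at $s$ with $\varphi\in H(s')$ for all $s'\in out(s,\sigma_A)$; (H5) if $\neg\langle\langle A\rangle\rangle\bigcirc\varphi\in H(s)$ there is a co-$A$-move $c$ at $s$ with $\neg\varphi\in H(s')$ for all $s'\in out(s,c)$; (H6) if $\langle\langle A\rangle\rangle\varphi\,\mathcal U\,\psi\in H(s)$ there is a perfect-recall $A$-strategy $F$ such that every $\lambda\in out(s,F)$ has $i\ge0$ with $\psi\in H(\lambda[i])$ and $\varphi\in H(\lambda[j])$ for all $j<i$; (H7)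 if $\neg\langle\langle A\rangle\rangle\Box\varphi\in H(s)$ there is a perfect-recall co-$A$-strategy $F$ such that every $\lambda\in out(s,F)$ has $i\ge0$ with $\neg\varphi\in H(\lambda[i])$. It is a CGHS for $\theta$ if $\theta\in H(s)$ for some $s\in S$. *)

(* Defs.v *)
From mathcomp Require Import all_boot.
From mathcomp Require Import classical_sets.

Set Implicit Arguments.
Unset Strict Implicit.
Unset Printing Implicit Defensive.

Local Open Scope classical_set_scope.

Inductive formula (Sigma : finType) (AP : Type) : Type :=
| Atom of AP
| Neg of formula Sigma AP
| Imp of formula Sigma AP & formula Sigma AP
| Next of {set Sigma} & formula Sigma AP
| Always of {set Sigma} & formula Sigma AP
| Until of {set Sigma} & formula Sigma AP & formula Sigma AP.

Arguments Atom {Sigma AP}.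

Definition And (Sigma : finType) (AP : Type) (phi psi : formula Sigma AP) :=
  Neg (Imp phi (Neg psi)).

(* [alpha_comp phi phi1 phi2]: [phi] is an alpha-formula with components
   [phi1] and [phi2]; likewise [beta_comp] for beta-formulae. *)
Inductive alpha_comp (Sigma : finType) (AP : Type) :
  formula Sigma AP -> formula Sigma AP -> formula Sigma AP -> Prop :=
| alpha_NegNeg phi : alpha_comp (Neg (Neg phi)) phi phi
| alpha_NegImp phi psi : alpha_comp (Neg (Imp phi psi)) phi (Neg psi)
| alpha_NegNext phi :
    alpha_comp (Neg (Next [set: Sigma]%SET phi))
      (Next finset.set0 (Neg phi)) (Next finset.set0 (Neg phi))
| alpha_Always A phi :
    alpha_comp (Always A phi) phi (Next A (Always A phi)).

Inductive beta_comp (Sigma : finType) (AP : Type) :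
  formula Sigma AP -> formula Sigma AP -> formula Sigma AP -> Prop :=
| beta_Imp phi psi : beta_comp (Imp phi psi) (Neg phi) psi
| beta_Until A phi psi :
    beta_comp (Until A phi psi) psi (And phi (Next A (Until A phi psi)))
| beta_NegUntil A phi psi :
    beta_comp (Neg (Until A phi psi))
      (And (Neg psi) (Neg phi))
      (And (Neg psi) (Neg (Next A (Until A phi psi))))
| beta_NegAlways A phi :
    beta_comp (Neg (Always A phi)) (Neg phi) (Neg (Next A (Always A phi))).

(* [nmoves a s] is d_a(s), so ['I_(nmoves a s)] is D_a(s) and the argument type
   of [delta s] is the product D(s). *)
Record frame (Sigma : finType) : Type := Frame {
  state :> Type;
  state_inhabited : inhabited state;
  nmoves : Sigma -> state -> nat;
  nmoves_gt0 : forall a s, 0 < nmoves a s;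
  delta : forall s, {dffun forall a : Sigma, 'I_(nmoves a s)} -> state
}.

Section Frames.
Variables (Sigma : finType) (G : frame Sigma).
Implicit Types (A : {set Sigma}) (s : G) (lam : nat -> G).

Definition move_vec s := {dffun forall a : Sigma, 'I_(nmoves a s)}.

Definition A_move A s :=
  {dffun forall a : {a : Sigma | a \in A}, 'I_(nmoves (val a) s)}.

Definition agrees A s (sig : move_vec s) (sigA : A_move A s) : Prop :=
  forall a : {a : Sigma | a \in A}, sig (val a) = sigA a.

Record co_A_move A s : Type := CoAMove {
  co_fun :> A_move A s -> move_vec s;
  co_agrees : forall sigA, agrees (co_fun sigA) sigA
}.

Definition out_move A s (sigA : A_move A s) : set G :=
  [set delta sig | sig in [set sig : move_vec s | agrees sig sigA]].

Definition out_co_move A s (c : co_A_move A s) : set G :=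
  [set delta (c sigA) | sigA in [set: A_move A s]].

Definition is_run lam : Prop :=
  forall i, exists sig : move_vec (lam i), lam i.+1 = delta sig.

(* A non-empty finite sequence of states ending at [t] is given as [h] followed
   by [t], so that the sequence [lam 0, ..., lam i] is the pair of
   [mkseq lam i] and [lam i]. *)
Definition strategy A := forall (h : seq G) (t : G), A_move A t.

Definition co_strategy A := forall (h : seq G) (t : G), co_A_move A t.

Definition out_strategy A s (F : strategy A) : set (nat -> G) :=
  [set lam | [/\ is_run lam, lam 0 = s &
    forall i, out_move (F (mkseq lam i) (lam i)) (lam i.+1)]].

Definition out_co_strategy A s (F : co_strategy A) : set (nat -> G) :=
  [set lam | [/\ is_run lam, lam 0 = s &
    forall i, out_co_move (F (mkseq lam i) (lam i)) (lam i.+1)]].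

End Frames.

Record model (Sigma : finType) (AP : Type) : Type := Model {
  model_frame :> frame Sigma;
  label : model_frame -> set AP
}.

Fixpoint sat (Sigma : finType) (AP : Type) (M : model Sigma AP) (s : M)
    (theta : formula Sigma AP) {struct theta} : Prop :=
  match theta with
  | Atom p => label s p
  | Neg phi => ~ sat s phi
  | Imp phi psi => sat s phi -> sat s psi
  | Next A phi =>
      exists sigA : A_move A s, forall s', out_move sigA s' -> sat s' phi
  | Always A phi =>
      exists F : strategy M A, forall lam, out_strategy s F lam ->
        forall i, sat (lam i) phi
  | Until A phi psi =>
      exists F : strategy M A, forall lam, out_strategy s F lam ->
        exists i, sat (lam i) psi /\ forall j, j < i -> sat (lam j) phi
  end.

Record hintikka (Sigma : finType) (AP : Type) : Type := Hintikka {
  hframe :> frame Sigma;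
  hlabel : hframe -> set (formula Sigma AP);
  hintikka_H1 : forall s phi, hlabel s (Neg phi) -> ~ hlabel s phi;
  hintikka_H2 : forall s alpha alpha1 alpha2, alpha_comp alpha alpha1 alpha2 ->
    hlabel s alpha -> hlabel s alpha1 /\ hlabel s alpha2;
  hintikka_H3 : forall s beta beta1 beta2, beta_comp beta beta1 beta2 ->
    hlabel s beta -> hlabel s beta1 \/ hlabel s beta2;
  hintikka_H4 : forall s A phi, hlabel s (Next A phi) ->
    exists sigA : A_move A s, forall s', out_move sigA s' -> hlabel s' phi;
  hintikka_H5 : forall s A phi, hlabel s (Neg (Next A phi)) ->
    exists c : co_A_move A s, forall s', out_co_move c s' ->
      hlabel s' (Neg phi);
  hintikka_H6 : forall s A phi psi, hlabel s (Until A phi psi) ->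
    exists F : strategy hframe A, forall lam, out_strategy s F lam ->
      exists i, hlabel (lam i) psi /\ forall j, j < i -> hlabel (lam j) phi;
  hintikka_H7 : forall s A phi, hlabel s (Neg (Always A phi)) ->
    exists F : co_strategy hframe A, forall lam, out_co_strategy s F lam ->
      exists i, hlabel (lam i) (Neg phi)
}.

Definition hintikka_for (Sigma : finType) (AP : Type)
    (HS : hintikka Sigma AP) (theta : formula Sigma AP) : Prop :=
  exists s : HS, hlabel s theta.

(* Main.v *)
Require Import Defs.
From mathcomp Require Import all_boot.
From mathcomp Require Import boolp classical_sets.

Local Open Scope classical_set_scope.

(** By induction on [phi], for all [s] simultaneously: [phi] in [H(s)] implies
    that [phi] holds at [s], and [Neg phi] in [H(s)] implies that [phi] fails
    at [s].  A positive [Always] and a negated [Until] are not covered by the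
    eventuality conditions (H6) and (H7): they propagate along a positional
    strategy (resp. co-strategy) assembled from the moves given by (H4)
    (resp. (H5)).  When [Neg phi] is in [H(s)], a strategy witnessing [phi] at
    [s] is played against the co-strategy, and their common outcome yields the
    contradiction. *)

Section Outcomes.
Set Implicit Arguments.
Unset Strict Implicit.
Variables (Sigma : finType) (G : frame Sigma).
Implicit Types (A : {set Sigma}) (s : G).

Lemma A_move_inhabited A s : inhabited (A_move A s).
Proof.
by split; exact: (finfun (fun a => Ordinal (nmoves_gt0 (val a) s))).
Qed.

Lemma A_move_extends A s (sigA : A_move A s) :
  exists sig : move_vec s, agrees sig sigA.
Proof.
(* Agents outside [A] play move 0, which is legal by [nmoves_gt0]. *)
exists (finfun (fun a =>
  if @idP (a \in A) is ReflectT aA then sigA (exist _ a aA)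
  else Ordinal (nmoves_gt0 a s))).
move=> [a aA] /=; rewrite ffunE; case: {-}_ / idP => [aA'|//].
by rewrite (bool_irrelevance aA' aA).
Qed.

Lemma co_A_move_inhabited A s : inhabited (co_A_move A s).
Proof.
by split; exact: (CoAMove (fun sigA => projT2 (cid (A_move_extends sigA)))).
Qed.

Lemma run_of_responses (next : seq G -> forall t : G, move_vec t) s :
  exists lam : nat -> G,
    lam 0 = s /\ forall i, lam i.+1 = delta (next (mkseq lam i) (lam i)).
Proof.
(* The response depends on the whole past, so the iteration carries the history along with the
   current state. *)
pose step (p : seq G * G) := (rcons p.1 p.2, delta (next p.1 p.2)).
pose play i := iter i step ([::], s).
exists (fun i => (play i).2); split=> // i.
suff <- : (play i).1 = mkseq (fun j => (play j).2) i by [].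
by elim: i => // i IHi; rewrite mkseqS -IHi.
Qed.

(** [Fc] answers the move of [F] with a full vector agreeing with it, so each successor lies in both
    outcome sets. *)
Lemma outcomes_meet A s (F : strategy G A) (Fc : co_strategy G A) :
  exists lam, out_strategy s F lam /\ out_co_strategy s Fc lam.
Proof.
have [lam [lam0 lamS]] := run_of_responses (fun h t => Fc h t (F h t)) s.
have run : is_run lam by move=> i; rewrite lamS; eexists.
exists lam; split; split=> // i; rewrite lamS.
  by exists (Fc (mkseq lam i) (lam i) (F (mkseq lam i) (lam i)));
    first exact: co_agrees.
by exists (F (mkseq lam i) (lam i)).
Qed.

End Outcomes.

Section Truth.
Set Implicit Arguments.
Unset Strict Implicit.
Variables (Sigma : finType) (AP : Type) (HS : hintikka Sigma AP).
Implicit Types (A : {set Sigma}) (phi psi : formula Sigma AP).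

Lemma hlabel_And (s : HS) phi psi :
  hlabel s (And phi psi) -> hlabel s phi /\ hlabel s psi.
Proof.
move=> /(hintikka_H2 (alpha_NegImp _ _))[Hphi].
by move=> /(hintikka_H2 (alpha_NegNeg _))[Hpsi _].
Qed.

(** Moves are chosen state by state; an arbitrary one fills in where [Next A phi] is absent, so [f]
    is total and yields a positional strategy. *)
Lemma Next_moves A phi : exists f : forall t : HS, A_move A t,
  forall t, hlabel t (Next A phi) ->
  forall t', out_move (f t) t' -> hlabel t' phi.
Proof.
have P (t : HS) : exists m : A_move A t, hlabel t (Next A phi) ->
    forall t', out_move m t' -> hlabel t' phi.
  have [/hintikka_H4[m mP]|nN] := pselect (hlabel t (Next A phi)).
    by exists m.
  by have [m] := A_move_inhabited A t; exists m.
by exists (fun t => projT1 (cid (P t))) => t; exact: (projT2 (cid (P t))).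
Qed.

Lemma NegNext_co_moves A phi : exists f : forall t : HS, co_A_move A t,
  forall t, hlabel t (Neg (Next A phi)) ->
  forall t', out_co_move (f t) t' -> hlabel t' (Neg phi).
Proof.
have P (t : HS) : exists c : co_A_move A t, hlabel t (Neg (Next A phi)) ->
    forall t', out_co_move c t' -> hlabel t' (Neg phi).
  have [/hintikka_H5[c cP]|nN] := pselect (hlabel t (Neg (Next A phi))).
    by exists c.
  by have [c] := co_A_move_inhabited A t; exists c.
by exists (fun t => projT1 (cid (P t))) => t; exact: (projT2 (cid (P t))).
Qed.

Lemma hlabel_Always A phi (s : HS) : hlabel s (Always A phi) ->
  exists F : strategy HS A, forall lam, out_strategy s F lam ->
    forall i, hlabel (lam i) phi.
Proof.
move=> Hs; have [f fP] := Next_moves A (Always A phi).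
exists (fun _ t => f t) => lam [_ lam0 lamS] i.
(* The invariant is [Always A phi] itself: one component gives [phi] now, the other passes the
   invariant on. *)
suff /(hintikka_H2 (alpha_Always _ _))[] : hlabel (lam i) (Always A phi) by [].
elim: i => [|i /(hintikka_H2 (alpha_Always _ _))[_ HN]]; first by rewrite lam0.
exact: fP HN _ (lamS i).
Qed.

Lemma hlabel_NegUntil A phi psi (s : HS) : hlabel s (Neg (Until A phi psi)) ->
  exists F : co_strategy HS A, forall lam, out_co_strategy s F lam ->
    forall i, (forall j, j < i -> ~ hlabel (lam j) (Neg phi)) ->
    hlabel (lam i) (Neg psi).
Proof.
move=> Hs; have [f fP] := NegNext_co_moves A (Until A phi psi).
exists (fun _ t => f t) => lam [_ lam0 lamS] i nphi.
(* Both beta components contain [Neg psi], so it suffices to carry the negated [Until] up to [i].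
   The component with [Neg phi] would stop it, but is excluded before [i]. *)
suff /(hintikka_H3 (beta_NegUntil _ _ _))[/hlabel_And[]|/hlabel_And[]] :
  hlabel (lam i) (Neg (Until A phi psi)) by [].
elim: i nphi => [|i IHi] nphi; first by rewrite lam0.
have /(hintikka_H3 (beta_NegUntil _ _ _)) := IHi (fun j ji => nphi j (ltnW ji)).
case=> /hlabel_And[_ HN]; first by case: (nphi i (ltnSn i)).
exact: fP HN _ (lamS i).
Qed.

Definition hintikka_model : model Sigma AP :=
  Model (fun s : HS => [set p | hlabel s (Atom p)]).

(** Labels may omit both [phi] and [Neg phi], so neither half follows from the other. *)
Lemma truth phi (s : hintikka_model) :
  (hlabel (h:=HS) s phi -> sat s phi) /\
  (hlabel (h:=HS) s (Neg phi) -> ~ sat s phi).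
Proof.
elim: phi s => [p|phi IH|phi IHphi psi IHpsi|A phi IH|A phi IH
               |A phi IHphi psi IHpsi] s /=.
- by split=> // /hintikka_H1.
- have [pos neg] := IH s; split=> //.
  by move=> /(hintikka_H2 (alpha_NegNeg _))[/pos sphi _]; apply.
- have [posphi negphi] := IHphi s; have [pospsi negpsi] := IHpsi s; split.
    by move=> /(hintikka_H3 (beta_Imp _ _))[/negphi|/pospsi].
  by move=> /(hintikka_H2 (alpha_NegImp _ _))[/posphi sphi /negpsi]; auto.
- split.
    move=> /hintikka_H4[sigA sigAP]; exists sigA => s' /sigAP.
    exact: (IH s').1.
  move=> /hintikka_H5[c cP] [sigA sigAP].
  (* The reply of [c] to [sigA] leads to a state common to both outcomes. *)
  have /cP/(IH _).2 : out_co_move c (delta (c sigA)) by exists sigA.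
  by apply; apply: sigAP; exists (c sigA) => //; exact: co_agrees.
- split.
    move=> /hlabel_Always[F FP]; exists F => lam /FP lamP i.
    exact: (IH _).1.
  move=> /hintikka_H7[Fc FcP] [F FP].
  have [lam [/FP lamP /FcP[i /(IH _).2]]] := outcomes_meet s F Fc.
  exact.
- split.
    move=> /hintikka_H6[F FP]; exists F => lam /FP[i [ipsi jphi]].
    by exists i; split=> [|j /jphi]; [exact: (IHpsi _).1|exact: (IHphi _).1].
  move=> /hlabel_NegUntil[Fc FcP] [F FP].
  have [lam [/FP[i [ipsi jphi]] /FcP lamP]] := outcomes_meet s F Fc.
  (* Since [phi] holds at each [j] before [i], induction keeps [Neg phi] out of those labels; hence
     [Neg psi] is in the label at [i]. *)
  apply: (IHpsi _).2 ipsi; apply: lamP => j /jphi sphi /(IHphi _).2.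
  exact.
Qed.

End Truth.

Theorem mainTheorem5 (Sigma : finType) (Sigma_gt0 : 0 < #|Sigma|) (AP : Type)
    (theta : formula Sigma AP) (HS : hintikka Sigma AP)
    (HStheta : hintikka_for HS theta) :
  exists L : HS -> set AP,
    (forall s : HS, L s = [set p | hlabel s (Atom p)]) /\
    exists s : Model L, sat s theta.
Proof.
have [s Hs] := HStheta.
exists (label (m:=hintikka_model HS)); split=> //.
by exists s; exact: (truth theta (s : hintikka_model HS)).1 Hs.
Qed.
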